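(* Let $m\ge 1$ be a natural number, let $\mathcal{T}$ be the set of trees with at most $m$ offspring per vertex, let $0<z<m^{-3/2}$, and let $\phi(v)=z^{\mathrm{gen}(v)}$ for $v\in\widetilde V$. Let $d$ be the distance on $\mathcal{T}$ defined by $$d(x,y)=\sum_{v\in\widetilde V}|x(v)-y(v)|\,\phi(v).$$ Then the majorizing measure condition is satisfied for $(\mathcal{T},d)$; that is, there exists a probability measure $\mu$ on $(\mathcal{T},d)$ such that $$\lim_{\delta\to 0}\ \sup_{t\in\mathcal{T}}\int_0^\delta\bigl[-\log \mu(B(t,u))\bigr]^{1/2}\,du=0,$$ where $B(t,u)$ is the ball in $(\mathcal{T},d)$ centered at $t$ with radius $u$.
   Context: Let $A=\{1,\dots,m\}$ and let $\widetilde V$ be the set of nonempty finite sequences of elements of $A$ starting with $1$ (the vertices; the sequence $1$ is the root). For $v\in\widetilde V$ and $a\in A$, $va$ denotes the sequence obtained by appending $a$ to $v$. The generation of $v=a_1\dots a_k$ is its length, $\mathrm{gen}(v)=k$, so the root has generation $1$. A tree is a function $x:\widetilde V\to\{0,1\}$ satisfying $x(v)\ge x(va)$ for all $v\in\widetilde V$, $a\in A$; $\mathcal{T}$ is the set of all trees (trees may have infinitely many vertices). Probability measures on $\mathcal{T}$ are defined on the Borel $\sigma$-field, which is generated by the sets $\{x\in\mathcal{T}: x(v)=1\}$, $v\in\widetilde V$. *)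

(* Defs.v *)
From HB Require Import structures.
From mathcomp Require Import all_boot all_order all_algebra.
From mathcomp Require Import all_classical all_reals all_analysis.

Set Implicit Arguments.
Unset Strict Implicit.
Unset Printing Implicit Defensive.

Import Order.TTheory GRing.Theory Num.Theory numFieldNormedType.Exports.

Local Open Scope classical_set_scope.
Local Open Scope ring_scope.

(* The alphabet {1, ..., m} is represented by 'I_m, the ordinal i standing for
   the letter i + 1; hence the letter 1 is the ordinal of value 0. *)
Definition is_vertex (m : nat) (s : seq 'I_m) : bool :=
  if s is a :: _ then nat_of_ord a == 0%N else false.

Record vertex (m : nat) : Type :=
  Vertex { vseq :> seq 'I_m ; vertexP : is_vertex vseq }.

HB.instance Definition _ (m : nat) := [isSub for @vseq m].
HB.instance Definition _ (m : nat) := [Countable of vertex m by <:].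

Definition gen (m : nat) (v : vertex m) : nat := size v.

Lemma is_vertex_rcons (m : nat) (v : vertex m) (a : 'I_m) :
  is_vertex (rcons v a).
Proof. by case: v => -[]. Qed.

Definition child (m : nat) (v : vertex m) (a : 'I_m) : vertex m :=
  Vertex (is_vertex_rcons v a).

(* The values 0 and 1 are booleans, compared through the coercion to nat.  The
   constant function 0 is a tree. *)
Record tree (m : nat) : Type := Tree {
  tree_fun :> vertex m -> bool ;
  treeP : forall (v : vertex m) (a : 'I_m),
    (tree_fun (child v a) <= tree_fun v)%N }.

Definition empty_tree (m : nat) : tree m :=
  @Tree m (fun=> false) (fun _ _ => leqnn _).

HB.instance Definition _ (m : nat) := gen_eqMixin (tree m).
HB.instance Definition _ (m : nat) := gen_choiceMixin (tree m).
HB.instance Definition _ (m : nat) := isPointed.Build (tree m) (empty_tree m).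

Definition tree_cylinders (m : nat) : set (set (tree m)) :=
  [set [set x : tree m | x v = true] | v in [set: vertex m]].

HB.instance Definition _ (m : nat) :=
  @isMeasurable.Build (sigma_display (@tree_cylinders m)) (tree m)
    <<s @tree_cylinders m >>
    (@sigma_algebra0 _ setT (@tree_cylinders m))
    (@sigma_algebraC _ (@tree_cylinders m))
    (@sigma_algebra_bigcup _ setT (@tree_cylinders m)).

(* The sum is unconditional over the countable set of vertices, in the extended
   reals so that no convergence proof is needed to write it. *)
Definition tree_dist (R : realType) (m : nat) (phi : vertex m -> R)
    (x y : tree m) : \bar R :=
  \esum_(v in [set: vertex m]) (`|(x v)%:R - (y v)%:R| * phi v)%:E.

Definition dist_ball (R : realType) (T : Type) (dist : T -> T -> \bar R)
    (t : T) (u : R) : set T :=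
  [set s | (dist t s < u%:E)%E].

(* Since lne 0 = -oo, the integrand is +oo when the ball has measure zero. *)
Definition majorizing_measure_condition (R : realType) (disp : measure_display)
    (T : measurableType disp) (dist : T -> T -> \bar R) : Prop :=
  exists mu : probability T R,
    ereal_sup [set (\int[lebesgue_measure]_(u in `]0%R, delta])
                      sqrte (- lne (mu (dist_ball dist t u))))%E | t in [set: T]]
      @[delta --> (0 : R)^'+] --> 0%E.

(* Main.v *)
Require Import Defs.
From HB Require Import structures.
From mathcomp Require Import all_boot all_order all_algebra.
From mathcomp Require Import all_classical all_reals all_analysis.
From mathcomp Require Import measurable_realfun ring lra.

(** The tree space is covered efficiently by finite trees, and this gives the
    majorizing measure.

    Cutting a tree after generation k moves it by at most
    [r_k = (mz)^k / (1 - mz)], because there are at most [m^j] vertices of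
    generation j, each of weight [z^j].  The cut tree is determined by the set
    of its vertices among those of generation at most k, of which there are at
    most [(k+1) m^k]; so [N_k <= 2 ^ ((k+1) m^k)] trees form an [r_k]-net
    ([tree_netP], [tree_dist_agree]).

    Let mu give mass [2^-(k+1)], spread evenly, to the net of level k.  A ball
    of radius [u > r_k] contains a point of that net, whence
    [- log mu(B(t,u)) <= log (2^(k+1) N_k) =: H_k] for every centre t
    ([sqrt_log_ball_le]).  On the range [r_(k+1) < u <= r_k] the integrand is
    thus at most [sqrt H_(k+1)], and the integral over [0 < u <= r_K] is
    at most the tail [sum_(k >= K) sqrt H_(k+1) * r_k], uniformly in t
    ([log_ball_integral_le]).  This tail tends to 0 as soon as the series
    converges ([entropy_majorizing_measure], the comparison of metric entropy
    with majorizing measures).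

    For trees [sqrt H_k] is at most [2 (k+1) m^(k/2)], so the terms of the
    series are of order [k (m^(3/2) z)^k], and [z < m^(-3/2)] is exactly what
    makes it converge. *)

Set Implicit Arguments.
Unset Strict Implicit.
Unset Printing Implicit Defensive.

Import Order.TTheory GRing.Theory Num.Theory numFieldNormedType.Exports.

Local Open Scope classical_set_scope.
Local Open Scope ring_scope.

(** * Integrals, limits and series *)

(** The integral of a nonnegative function is a supremum over the simple
    functions below it, hence monotone whatever the functions.  It is applied
    to [sqrt (- log mu(B(t,u)))] as a function of u, an integrand that is not
    assumed to be measurable. *)
Lemma ge0_integral_mono (d : measure_display) (T : measurableType d)
    (R : realType) (mu : {measure set T -> \bar R}) (D : set T)
    (f g : T -> \bar R) :
  (forall x, D x -> 0 <= f x)%E -> (forall x, D x -> f x <= g x)%E ->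
  (\int[mu]_(x in D) f x <= \int[mu]_(x in D) g x)%E.
Proof.
move=> f0 fg.
have g0 x : D x -> (0 <= g x)%E by move=> Dx; rewrite (le_trans (f0 _ Dx)) ?fg.
rewrite (ge0_integralE _ f0) (ge0_integralE _ g0).
apply: ereal_sup_le => _ [h hf <-]; exists h => // x.
apply: le_trans (hf x) _; rewrite /patch; case: ifP => // xD.
by apply: fg; apply: set_mem.
Qed.

Lemma ge0_cvge0P (R : realType) (I : Type) (F : set_system I)
    {FF : Filter F} (f : I -> \bar R) : (forall x, 0 <= f x)%E ->
  f @ F --> 0%E <-> (forall e, 0 < e -> \forall x \near F, (f x < e%:E)%E).
Proof.
move=> f0; split=> [/fine_cvgP[ffin fcvg] e e0|fe].
  near=> x; rewrite -[f x]fineK ?lte_fin; last by near: x.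
  near: x; exact: (cvgr_lt _ fcvg).
apply/fine_cvgP; split.
  apply: filterS (fe 1 ltr01) => x fx1.
  by rewrite ge0_fin_numE// (lt_trans fx1)// ltry.
apply/cvgrPdist_lt => e e0; apply: filterS (fe e e0) => x fxe.
have fx : f x \is a fin_num by rewrite ge0_fin_numE// (lt_trans fxe)// ltry.
by rewrite sub0r normrN ger0_norm ?fine_ge0// -lte_fin fineK.
Unshelve. all: end_near. Qed.

(** With [y = sqrt q], [(k+1) y^k] is at most [1 + y + ... + y^k], which is
    bounded, so [(k+1) q^k] is dominated by the geometric term [y^k]. *)
Lemma linear_geometric_summable (R : realType) (C q : R) :
  0 <= C -> 0 < q < 1 ->
  (\sum_(0 <= k <oo) (C * (k.+1%:R * q ^+ k))%:E < +oo)%E.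
Proof.
move=> C0 /andP[q0 q1]; pose y := Num.sqrt q.
have y0 : 0 < y by rewrite sqrtr_gt0.
have qy : q = y ^+ 2 by rewrite sqr_sqrtr// ltW.
have y1 : y < 1 by rewrite -[ltRHS]sqrtr1 ltr_sqrt.
have ny1 : `|y| < 1 by rewrite gtr0_norm.
have lin k : k.+1%:R * y ^+ k <= 1 / (1 - y).
  apply: le_trans (geometric_le_lim k.+1 ler01 y0 ny1).
  rewrite /series/= mulr_natl -[in leLHS](subn0 k.+1) -sumr_const_nat.
  apply: ler_sum_nat => j /andP[_ jk].
  by rewrite mul1r ler_wiXn2l// ltW.
apply: (@le_lt_trans _ _ (C / (1 - y) / (1 - y))%:E); last exact: ltry.
apply: lime_le.
  apply: is_cvg_nneseries => k _ _.
  by rewrite lee_fin !mulr_ge0// exprn_ge0// ltW.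
apply: nearW => n /=; rewrite sumEFin lee_fin.
have Cy : 0 <= C / (1 - y) by rewrite divr_ge0// subr_ge0 ltW.
apply: le_trans (geometric_le_lim n Cy y0 ny1).
apply: ler_sum => k _ /=; rewrite -!mulrA ler_wpM2l//.
rewrite qy -exprM mulnC exprM expr2 mulrA ler_wpM2r ?(exprn_ge0 _ (ltW y0))//.
by rewrite -[leRHS]mul1r.
Qed.

(** * From entropy to a majorizing measure *)

Section discrete_measure.
Variables (R : realType) (d : measure_display) (T : measurableType d).
Variables (net : nat -> nat -> T) (N : nat -> nat).

Definition net_weight (k : nat) : {nonneg R} :=
  ((2 ^ k.+1 * N k)%:R^-1)%:nng.

(** A combination of Dirac masses has a value on every set and is monotone on
    all sets; this matters for the balls of an arbitrary [dist], which may fail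
    to be measurable. *)
Definition net_measure : {measure set T -> \bar R} :=
  mseries (fun k => mscale (net_weight k)
    (msum (fun i => dirac (net k i)) (N k))) 0.

Lemma net_measureE (A : set T) :
  net_measure A = (\sum_(0 <= k <oo) ((net_weight k)%:num *
    \sum_(i < N k) \1_A (net k i))%:E)%E.
Proof.
apply: eq_eseriesr => k _ /=; rewrite /mscale/= /msum EFinM -sumEFin.
by congr (_ * _)%E; apply: eq_bigr => i _; rewrite diracE indicE.
Qed.

Lemma net_measure_setT : (forall k, (0 < N k)%N) ->
  net_measure [set: T] = 1%E.
Proof.
move=> N0; rewrite net_measureE.
have -> : 1%E = ((1 : R) / 2 ^+ 0)%:E by rewrite expr0 divr1.
rewrite -(cvg_lim _ (@cvg_geometric_eseries_half R 1 0))//.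
apply: eq_eseriesr => k _; congr (_%:E).
under eq_bigr do rewrite indicT.
rewrite /= sumr_const card_ord -mulr_natl mulr1 natrM invfM -mulrA mulVf.
  by rewrite addn1 mulr1 mul1r.
by rewrite pnatr_eq0 -lt0n.
Qed.

Lemma net_measure_ge (A : set T) (k i : nat) :
  (i < N k)%N -> A (net k i) -> ((net_weight k)%:num%:E <= net_measure A)%E.
Proof.
move=> iN Ai; rewrite net_measureE.
apply: le_trans (nneseries_lim_ge k.+1 _); last first.
  by move=> n _ _; rewrite lee_fin mulr_ge0// sumr_ge0.
rewrite big_nat_recr//= -[leLHS]add0e leeD//.
  by apply: sume_ge0 => n _; rewrite lee_fin mulr_ge0// sumr_ge0.
rewrite lee_fin -[leLHS]mulr1 ler_wpM2l// (bigD1 (Ordinal iN))//= indicE.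
by rewrite mem_set// lerDl sumr_ge0.
Qed.
End discrete_measure.

Section dudley.
Variables (R : realType) (d : measure_display) (T : measurableType d).
Variables (dist : T -> T -> \bar R) (net : nat -> nat -> T) (N : nat -> nat).
Variables (r : nat -> R).

(** Minus the logarithm of the mass given to a single point of the k-th net:
    the metric entropy [ln (N k)], plus the price of sharing the mass among
    all the levels. *)
Definition net_entropy (k : nat) : R := ln (2 ^ k.+1 * N k)%:R.

Hypothesis N0 : forall k, (0 < N k)%N.
Hypothesis netP : forall t k, exists2 i, (i < N k)%N &
  (dist t (net k i) <= (r k)%:E)%E.

Let mu := net_measure R net N.

Lemma sqrt_log_ball_le (t : T) (u : R) (k : nat) : r k < u ->
  (sqrte (- lne (mu (dist_ball dist t u))) <= (Num.sqrt (net_entropy k))%:E)%E.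
Proof.
move=> ru; have [i iN di] := netP t k.
have Mpos : 0 < (2 ^ k.+1 * N k)%:R :> R.
  by rewrite ltr0n muln_gt0 expn_gt0 N0.
have H0 : 0 <= net_entropy k.
  by rewrite ln_ge0// ler1n muln_gt0 expn_gt0 N0.
change (sqrte (- lne (mu (dist_ball dist t u))) <= sqrte (net_entropy k)%:E)%E.
rewrite lee_sqrt ?lee_fin// leeNl.
have -> : (- (net_entropy k)%:E = lne ((@net_weight R N k)%:num%:E : \bar R))%E.
  by rewrite /= invr_le0 leNgt Mpos/= lnV ?posrE// EFinN.
have B := @net_measure_ge R d T net N (dist_ball dist t u) k i iN _.
rewrite lee_lne ?B ?in_itv/= ?leey ?andbT ?lee_fin ?measure_ge0//.
  by rewrite /dist_ball/=; apply: le_lt_trans di _; rewrite lte_fin.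
Qed.

Hypothesis r0 : forall k, 0 < r k.
Hypothesis r_cvg : r @ \oo --> 0.

(** If k is the first index at least K with [r k < u], then k is not K itself,
    as [u <= delta <= r K], and so [u <= r (k-1)].  Hence the integrand is at
    most the term of index [k-1] in the series of functions
    [sqrt (net_entropy (k+1))] times the indicator of [0 < u <= r k], and
    integrating that series term by term gives the bound. *)
Lemma log_ball_integral_le (t : T) (K : nat) (delta : R) : delta <= r K ->
  (\int[lebesgue_measure]_(u in `]0%R, delta])
    sqrte (- lne (mu (dist_ball dist t u))) <=
   \sum_(K <= k <oo) (Num.sqrt (net_entropy k.+1) * r k)%:E)%E.
Proof.
move=> dK.
(* The series is indexed from 0 so that it can be integrated term by term. *)
pose g k (u : R) : \bar R :=
  ((Num.sqrt (net_entropy (k + K).+1))%:E * (\1_(`]0, r (k + K)]) u)%:E)%E.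
have g0 k u : (0 <= g k u)%E by rewrite /g -EFinM lee_fin mulr_ge0.
have mg k : measurable_fun `]0, delta] (g k).
  apply/measurable_funeM/measurable_EFinP; exact: measurable_indic.
apply: (@le_trans _ _ (\int[lebesgue_measure]_(u in `]0%R, delta])
    \sum_(0 <= k <oo) g k u)%E).
  apply: ge0_integral_mono => [u _|u /=]; first exact: sqrte_ge0.
  rewrite in_itv/= => /andP[u0 ud].
  have [j ruj jmin] : exists2 j, r (j + K)%N < u &
      forall i, (i < j)%N -> u <= r (i + K)%N.
    have ex : exists j, r (j + K)%N < u.
      have [n _ /(_ (n + K)%N (leq_addr _ _))] :
        \forall k \near \oo, r k < u by exact: (cvgr_lt _ r_cvg).
      by exists n.
    case: (ex_minnP ex) => j ruj jmin; exists j => // i; apply: contraTT.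
    by rewrite -ltNge -leqNgt => /jmin.
  case: j ruj jmin => [|j] ruj jmin.
    by move: (lt_le_trans ruj ud); rewrite add0n ltNge dK.
  apply: le_trans (nneseries_lim_ge j.+1 _); last by move=> *; exact: g0.
  rewrite big_nat_recr//= -[leLHS]add0e leeD//; first exact: sume_ge0.
  rewrite /g indicE mem_set ?mule1; last by rewrite /= in_itv/= u0 jmin.
  exact: sqrt_log_ball_le.
rewrite integral_nneseries//.
apply: (@le_trans _ _ (\sum_(0 <= k <oo)
   (Num.sqrt (net_entropy (k + K).+1) * r (k + K))%:E)%E).
  apply: lee_nneseries => [k _ _|k _]; first exact: integral_ge0.
  rewrite ge0_integralZl//; last exact/measurable_EFinP/measurable_indic.
  rewrite integral_indic//.
  rewrite EFinM lee_wpmul2l// ?lee_fin//.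
  apply: (@le_trans _ _ (lebesgue_measure (`]0, r (k + K)]%classic : set R))).
    by apply: le_measure; rewrite ?inE//; exact: measurableI.
  rewrite lebesgue_measure_itv/= lte_fin; case: ifP => _.
    by rewrite oppr0 adde0.
  by rewrite lee_fin ltW.
rewrite (@nneseries_addn _ (fun k => (Num.sqrt (net_entropy k.+1) * r k)%:E))//.
by move=> k; rewrite lee_fin mulr_ge0// ltW.
Qed.

Hypothesis entropy_summable :
  (\sum_(0 <= k <oo) (Num.sqrt (net_entropy k.+1) * r k)%:E < +oo)%E.

(** The bound of [log_ball_integral_le] is a tail of a convergent series, the
    same for all centres, and it holds as soon as [delta <= r K], that is, for
    all small enough positive [delta]. *)
Lemma log_ball_sup_cvg :
  ereal_sup [set (\int[lebesgue_measure]_(u in `]0%R, delta])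
      sqrte (- lne (mu (dist_ball dist t u))))%E | t in [set: T]]
    @[delta --> (0 : R)^'+] --> 0%E.
Proof.
have tail : (\sum_(K <= k <oo) (Num.sqrt (net_entropy k.+1) * r k)%:E)%E
    @[K --> \oo] --> 0%E.
  apply: (nneseries_tail_cvg entropy_summable) => k _.
  by rewrite lee_fin mulr_ge0// ltW.
have tail0 K :
    (0 <= \sum_(K <= k <oo) (Num.sqrt (net_entropy k.+1) * r k)%:E)%E.
  by apply: nneseries_ge0 => k _ _; rewrite lee_fin mulr_ge0// ltW.
apply/ge0_cvge0P => [delta|e e0].
  pose t := net 0%N 0%N.
  apply: ereal_sup_ge; exists (\int[lebesgue_measure]_(u in `]0%R, delta])
      sqrte (- lne (mu (dist_ball dist t u))))%E; first by exists t.
  by apply: integral_ge0 => u _; exact: sqrte_ge0.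
have [K _ /(_ K (leqnn K)) Ke] := (ge0_cvge0P tail0).1 tail e e0.
near=> delta; apply: le_lt_trans Ke; apply: ge_ereal_sup => _ [t _ <-].
apply: log_ball_integral_le; near: delta; exact: nbhs_right_le.
Unshelve. all: end_near. Qed.

(** Dudley's entropy condition implies the majorizing measure condition. *)
Theorem entropy_majorizing_measure : majorizing_measure_condition dist.
Proof.
pose muP := Measure_isProbability.Build _ _ _ mu (net_measure_setT R net N0).
pose P : probability T R := HB.pack (Measure.sort mu) (Measure.class mu) muP.
exists P; exact: log_ball_sup_cvg.
Qed.
End dudley.

(** * Nets of finite trees *)

Section trees.
Variable m : nat.
Implicit Types (v w : vertex m) (x y t : tree m).

Lemma tree_prefix x v w : prefix v w -> x w -> x v.
Proof.
case/prefixP => s; elim/last_ind: s w => [|s a IH] w ws.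
  by move: ws; rewrite cats0 => /val_inj ->.
have vs : is_vertex (v ++ s) by case: v {IH ws} => -[].
move=> xw; apply: (IH (Vertex vs)) => //.
have := treeP x (Vertex vs) a; have -> : child (Vertex vs) a = w.
  by apply: val_inj; rewrite /= rcons_cat -ws.
by rewrite xw; case: (x (Vertex vs)).
Qed.

(** The smallest tree containing the vertices of s. *)
Definition hull_fun (s : seq (vertex m)) v : bool :=
  has (fun w => prefix v w) s.

Lemma hull_funP s v a : (hull_fun s (child v a) <= hull_fun s v)%N.
Proof.
suff /implyP : hull_fun s (child v a) -> hull_fun s v by do 2 case: hull_fun.
apply/sub_has => w /prefixP[u wu].
by apply/prefixP; exists (a :: u); rewrite wu /= cat_rcons.
Qed.

Definition hull (s : seq (vertex m)) : tree m := Tree (hull_funP s).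

Definition words (k : nat) : seq (seq 'I_m) :=
  [seq val u | u <- enum {: k.-tuple 'I_m}].

Lemma size_words k : size (words k) = (m ^ k)%N.
Proof. by rewrite size_map -cardE card_tuple card_ord. Qed.

Lemma mem_words k (s : seq 'I_m) : size s = k -> s \in words k.
Proof.
by move=> sk; apply/mapP; exists (Tuple (introT eqP sk)); rewrite ?mem_enum.
Qed.

(** Words not starting with the root letter are discarded by [insub]; counting
    them nevertheless, as [size_vertices] does, costs about a factor m, which
    does not affect the growth rate in k. *)
Definition vertices (k : nat) : seq (vertex m) :=
  pmap insub (flatten [seq words j | j <- iota 0 k.+1]).

Lemma mem_vertices k v : (gen v <= k)%N -> v \in vertices k.
Proof.
move=> vk; rewrite mem_pmap_sub; apply/flattenP; exists (words (gen v)).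
  by apply: map_f; rewrite mem_iota.
exact: mem_words.
Qed.

Lemma size_vertices k : (0 < m)%N -> (size (vertices k) <= k.+1 * m ^ k)%N.
Proof.
move=> m0; rewrite size_pmap; apply: leq_trans (count_size _ _) _.
rewrite size_flatten /shape -map_comp sumnE big_map.
apply: (@leq_trans (\sum_(0 <= j < k.+1) m ^ k)%N).
  rewrite /index_iota subn0 !big_seq; apply: leq_sum => j.
  by rewrite mem_iota /= => jk; rewrite size_words leq_pexp2l.
by rewrite sum_nat_const_nat subn0.
Qed.

(** A tree is closed under prefixes, so the hull adds nothing to the vertices
    selected, and the hull is t cut after generation k. *)
Lemma hull_vertices t k v : (gen v <= k)%N ->
  hull [seq w <- vertices k | t w] v = t v.
Proof.
move=> vk; apply/hasP/idP => [[w]|tv].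
  by rewrite mem_filter => /andP[tw _] /tree_prefix; apply.
by exists v; rewrite ?prefix_refl// mem_filter tv mem_vertices.
Qed.

Lemma count_gen (s : seq (vertex m)) j : uniq s ->
  (count (fun v => gen v == j) s <= m ^ j)%N.
Proof.
move=> us; rewrite -size_filter -(size_map val) -size_words.
apply: uniq_leq_size.
  by rewrite map_inj_uniq ?filter_uniq//; exact: val_inj.
move=> _ /mapP[v vj ->]; apply: mem_words; apply/eqP.
by move: vj; rewrite mem_filter => /andP[].
Qed.

Section distance.
Variables (R : realType) (z : R).
Hypotheses (m0 : (0 < m)%N) (z0 : 0 < z) (mz1 : m%:R * z < 1).

(** Only the vertices of generation [j > k] contribute, and those of
    generation j contribute at most [m^j z^j] in total, so the distance is at
    most a geometric tail. *)
Lemma tree_dist_agree x y k : (forall v, (gen v <= k)%N -> x v = y v) ->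
  (tree_dist (fun v => (z ^+ gen v)%R) x y <=
   ((m%:R * z) ^+ k / (1 - m%:R * z))%:E)%E.
Proof.
move=> xy; apply: ge_ereal_sup => _ [A [Afin _] <-].
rewrite fsbig_finite//=; set s := finmap.enum_fset _.
have us : uniq s by exact: finmap.fset_uniq.
rewrite sumEFin lee_fin.
(* Sort the finite sum by generation; M bounds the generations that occur. *)
pose M := \max_(v <- s) gen v.
pose G j : R := if (k < j)%N then z ^+ j else 0.
apply: (@le_trans _ _ (\sum_(v <- s) \sum_(j < k + M.+1) G j *+ (gen v == j))).
  rewrite !big_seq; apply: ler_sum => v vs.
  have vM : (gen v < k + M.+1)%N.
    by rewrite addnS ltnS (leq_trans _ (leq_addl _ _))// leq_bigmax_seq.
  rewrite (bigD1 (Ordinal vM))//= eqxx mulr1n big1 => [|j /eqP jv]; last first.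
    by case: eqP => // vj; case: jv; apply: val_inj.
  rewrite addr0 /G; case: leqP => [/xy ->|_].
    by rewrite subrr normr0 mul0r.
  rewrite ler_piMl ?(exprn_ge0 _ (ltW z0))//.
  by move: (x v) (y v) => [] [];
    rewrite ?subrr ?sub0r ?subr0 ?normrN ?normr0 ?normr1//.
rewrite exchange_big/=.
apply: (@le_trans _ _ (\sum_(k <= j < k + M.+1) (m%:R * z) ^+ j)).
  rewrite -(big_mkord xpredT (fun j => \sum_(v <- s) G j *+ (gen v == j))).
  rewrite (big_cat_nat (leq0n k) (leq_addr _ _))/= big_nat big1 ?add0r;
    last first.
    move=> j /andP[_ jk]; rewrite big1// => v _.
    by rewrite /G ltnNge ltnW//= mul0rn.
  apply: ler_sum => j _; rewrite sumrMnr.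
  have -> : (\sum_(v <- s) (gen v == j) = count (fun v => gen v == j) s)%N.
    by rewrite -sumn_count sumnE big_map.
  rewrite /G; case: ifP => [_|_]; last first.
    by rewrite mul0rn exprn_ge0// mulr_ge0// ltW.
  rewrite exprMn -[leLHS]mulr_natl ler_wpM2r ?(exprn_ge0 _ (ltW z0))//.
  by rewrite -natrX ler_nat count_gen.
have mz0 : 0 < m%:R * z by rewrite mulr_gt0// ltr0n.
rewrite geometric_partial_tail geometric_le_lim ?(exprn_ge0 _ (ltW mz0))//.
by rewrite gtr0_norm.
Qed.
End distance.

Definition net_size (k : nat) : nat := (2 ^ size (vertices k))%N.

(** The subsets of [vertices k] are enumerated as boolean masks. *)
Definition tree_net (k i : nat) : tree m :=
  hull (mask (nth (nseq_tuple _ false)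
    (enum {: (size (vertices k)).-tuple bool}) i) (vertices k)).

Lemma tree_netP t k : exists2 i, (i < net_size k)%N &
  forall v, (gen v <= k)%N -> t v = tree_net k i v.
Proof.
pose b := map_tuple t (in_tuple (vertices k)).
exists (index b (enum {: (size (vertices k)).-tuple bool})) => [|v vk].
  have <- : #|{: (size (vertices k)).-tuple bool}| = net_size k.
    by rewrite card_tuple card_bool.
  by rewrite cardE index_mem mem_enum.
by rewrite /tree_net nth_index ?mem_enum// -filter_mask hull_vertices.
Qed.
End trees.

(** The entropy is at most [k+1 + (k+1) m^k], as [ln 2 <= 1]; the square of the
    right-hand side is [4 (k+1)^2 m^k], which is at least
    as large. *)
Lemma sqrt_tree_entropy_le (R : realType) (m k : nat) : (0 < m)%N ->
  Num.sqrt (net_entropy R (net_size m) k) <=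
  2 * (k.+1%:R * Num.sqrt m%:R ^+ k) :> R.
Proof.
move=> m0; rewrite -[leRHS]ger0_norm -?sqrtr_sqr; last first.
  by rewrite !mulr_ge0// exprn_ge0// sqrtr_ge0.
rewrite ler_wsqrtr// !exprMn -exprM mulnC exprM sqr_sqrtr//.
rewrite /net_entropy /net_size -expnD natrX lnXn// -[leLHS]mulr_natl.
have mk : 1 <= m%:R ^+ k :> R by rewrite exprn_ege1// ler1n.
have ln2 : ln 2 <= 1 :> R.
  by rewrite -[2]/(1 + 1) le_ln1Dx//; lra.
apply: (@le_trans _ _ (k.+1%:R + k.+1%:R * m%:R ^+ k)).
  apply: (@le_trans _ _ ((k.+1 + size (vertices m k))%:R * 1)).
    by rewrite ler_wpM2l.
  by rewrite mulr1 -natrX -natrM -natrD ler_nat leq_add2l size_vertices.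
have k1 : 1 <= k.+1%:R :> R by rewrite ler1n.
nra.
Qed.

Theorem lemma5p2 (R : realType) (m : nat) (z : R) (hm : (1 <= m)%N)
    (hz0 : 0 < z) (hz : z < m%:R `^ (- (3 / 2))) :
  majorizing_measure_condition
    (tree_dist (fun v : vertex m => z ^+ gen v)).
Proof.
(* The series of the entropy bound has ratio [s * a], that is, m^(3/2) z. *)
pose s := Num.sqrt (m%:R : R); pose a := m%:R * z.
have m1 : 1 <= m%:R :> R by rewrite ler1n.
have m0 : 0 < m%:R :> R by rewrite ltr0n.
have s1 : 1 <= s by rewrite -[leLHS]sqrtr1 ler_sqrt.
have s0 : 0 < s by exact: lt_le_trans s1.
have mE : m%:R `^ (3 / 2) = m%:R * s.
  have -> : (3 / 2 : R) = 1 + 2^-1 by field.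
  by rewrite powRD ?gt_eqF ?implybT// powRr1 ?powR12_sqrt// ltW.
have sa1 : s * a < 1.
  have -> : s * a = z * (m%:R * s) by rewrite /a; ring.
  by rewrite -ltr_pdivlMr ?mulr_gt0// div1r -mE -powRN.
have a0 : 0 < a by rewrite mulr_gt0.
have a1 : a < 1 by rewrite (le_lt_trans _ sa1)// ler_peMl// ltW.
pose r k := a ^+ k / (1 - a).
have r0 k : 0 < r k by rewrite divr_gt0 ?exprn_gt0 ?subr_gt0.
apply: (@entropy_majorizing_measure _ _ _ _ (@tree_net m) (net_size m) r) => //.
- by move=> k; rewrite expn_gt0.
- move=> t k; have [i iN ti] := tree_netP t k.
  by exists i => //; exact: tree_dist_agree.
- have -> : r = geometric (1 - a)^-1 a.
    by apply/funext => k; rewrite /r /geometric/= mulrC.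
  by apply: cvg_geometric; rewrite gtr0_norm.
apply: le_lt_trans
  (linear_geometric_summable (C := 4 * s / (1 - a)) (q := s * a) _ _).
- apply: lee_nneseries => k _; rewrite lee_fin.
    by rewrite mulr_ge0// ltW.
  apply: le_trans (ler_wpM2r (ltW (r0 k)) (sqrt_tree_entropy_le R k.+1 hm)) _.
  have -> : 4 * s / (1 - a) * (k.+1%:R * (s * a) ^+ k) =
      2 * (2 * k.+1%:R * s ^+ k.+1) * r k.
    by rewrite /r exprMn exprS; ring.
  apply: (ler_wpM2r (ltW (r0 k))); apply: ler_wpM2l => //.
  apply: (ler_wpM2r (exprn_ge0 _ (ltW s0))).
  by rewrite -natrM ler_nat mul2n -addnn addSn ltnS leq_addl.
- by rewrite divr_ge0 ?mulr_ge0 ?subr_ge0 ?ltW.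
- by rewrite mulr_gt0.
Qed.
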